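(* Let $S=(b_1^{(m_1)},b_2^{(m_2)},\ldots,b_l^{(m_l)})$ be a tree eccentric sequence with $m_1+m_2+\cdots+m_l>2$, and let $\mathcal{T}_S$ be the set of all trees whose eccentric sequence is $S$. Then $$W(T)>W\big(\mathbb{T}(m_l-2,m_{l-1}-2,\ldots,m_2-2)\big)$$ for all $T\in\mathcal{T}_S$ such that $T$ is not isomorphic to $\mathbb{T}(m_l-2,m_{l-1}-2,\ldots,m_2-2)$. Moreover, \begin{align*} W\big(\mathbb{T}(m_l-2,m_{l-1}-2,\ldots,m_2-2)\big)={}&\binom{b_l+2}{3}+\sum_{j=2}^{l}(m_j-2)(m_j-3)\\ &+\sum_{2\le i<j\le l}(m_i-2)(m_j-2)(2+j-i)\\ &+\sum_{j=1}^{l-1}\left(\binom{j+1}{2}+\binom{b_l+1-j}{2}\right)(m_{l+1-j}-2)\\ &+(b_l+1)\left(2-2l+\sum_{j=2}^{l}m_j\right). \end{align*}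
   Context: All graphs are finite and simple. In a connected graph $G$, $d_G(u,v)$ is the length of a shortest $u$-$v$ path, and the eccentricity of a vertex $u$ is $\mathrm{ecc}_G(u)=\max_{v\in V(G)}d_G(u,v)$. The eccentric sequence of $G$ is the nondecreasing sequence of the eccentricities of all vertices of $G$. It is written $(b_1^{(m_1)},\ldots,b_l^{(m_l)})$, meaning that $G$ has precisely $l$ distinct eccentricities $b_1<b_2<\cdots<b_l$ and that exactly $m_i\ge 1$ vertices have eccentricity $b_i$ (so $|V(G)|=m_1+\cdots+m_l$ and $b_l$ is the diameter). A sequence is a tree eccentric sequence if it is the eccentric sequence of some tree. The Wiener index of $G$ is $W(G)=\sum_{\{u,v\}\subseteq V(G)}d_G(u,v)$, the sum over all unordered pairs of vertices. A pendant vertex is a vertex of degree $1$. A caterpillar is a tree such that removing all pendant vertices produces a path. Given an integer $q>0$, let $r=q/2$ if $q$ is even and $r=(q+1)/2$ if $q$ is odd. For nonnegative integers $t_1,\ldots,t_r$, $\mathbb{T}(t_1,\ldots,t_r)$ is the caterpillar constructed from the path $v_0,v_1,\ldots,v_{q+1}$ by attaching $t_j$ new pendant vertices at $v_j$ for all $1\le j\le r$. In the notation $\mathbb{T}(m_l-2,m_{l-1}-2,\ldots,m_2-2)$ associated with $S$, the integer $q$ is $q=b_l-1$ (so the path $v_0,\ldots,v_{q+1}$ has length $b_l$), $r=l-1$, and $t_j=m_{l+1-j}-2$ for $1\le j\le l-1$. *)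

(* Defs.v *)
From HB Require Import structures.
From mathcomp Require Import all_boot all_order all_algebra.

Set Implicit Arguments.
Unset Strict Implicit.
Unset Printing Implicit Defensive.

Record sgraph := SGraph {
  vertex :> finType;
  edge : rel vertex;
  edge_sym : symmetric edge;
  edge_irrefl : irreflexive edge
}.

Definition isomorphic (G H : sgraph) : Prop :=
  exists f : G -> H,
    bijective f /\ forall x y : G, edge (f x) (f y) = edge x y.

Definition connected_graph (G : sgraph) : Prop :=
  0 < #|G| /\ forall x y : G, connect (@edge G) x y.

(* [ucycle e s] also holds for [:: x; y] with x, y adjacent, hence the bound
   on the size. *)
Definition acyclic (G : sgraph) : Prop :=
  forall s : seq G, 2 < size s -> ~ ucycle (@edge G) s.

Definition is_tree (G : sgraph) : Prop := connected_graph G /\ acyclic G.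

Definition has_path_of_length (G : sgraph) (x y : G) (n : nat) : bool :=
  [exists p : n.-tuple G,
    [&& path (@edge G) x p, uniq (x :: p) & last x p == y]].

(* A path has fewer than #|G| edges, so the least length is searched below
   #|G|; the value is #|G| if there is no path from x to y. *)
Definition dist (G : sgraph) (x y : G) : nat :=
  find (has_path_of_length x y) (iota 0 #|G|).

Definition ecc (G : sgraph) (x : G) : nat := \max_(y : G) dist x y.

Definition ecc_seq (G : sgraph) : seq nat :=
  sort leq [seq ecc x | x <- enum G].

(* The order on enum_rank selects each unordered pair {u, v}, u != v,
   exactly once. *)
Definition Wiener (G : sgraph) : nat :=
  \sum_(u : G) \sum_(v : G | enum_rank u < enum_rank v) dist u v.

Definition in_trees_with (S : seq nat) (T : sgraph) : Prop :=
  is_tree T /\ ecc_seq T = S.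

Definition tree_ecc_seq (S : seq nat) : Prop :=
  exists T : sgraph, in_trees_with S T.

(* The sequence (b_1^(m_1), ..., b_l^(m_l)); only the values of b and m at
   1, ..., l matter. *)
Definition expand_seq (l : nat) (b m : nat -> nat) : seq nat :=
  flatten [seq nseq (m i) (b i) | i <- iota 1 l].

Definition exponent_form (l : nat) (b m : nat -> nat) : Prop :=
  (forall i j, 1 <= i -> i < j -> j <= l -> b i < b j) /\
  (forall i, 1 <= i <= l -> 1 <= m i).

(* T(t_1, ..., t_r) with r = ceil(q / 2). The vertex inl i is the path vertex
   v_i, for 0 <= i <= q + 1. As j : 'I_r starts from 0, inr (Tagged _ k) with
   tag j is the k-th pendant vertex attached at v_(j + 1). *)
Section Caterpillar.
Variables (q : nat) (t : nat -> nat).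

Definition cat_vertex : finType :=
  ('I_q.+2 + {j : 'I_(uphalf q) & 'I_(t j.+1)})%type.

Definition cat_edge : rel cat_vertex := fun x y =>
  match x, y with
  | inl a, inl c => (a.+1 == c :> nat) || (c.+1 == a :> nat)
  | inl a, inr s => a == (tag s).+1 :> nat
  | inr s, inl a => a == (tag s).+1 :> nat
  | inr _, inr _ => false
  end.

Lemma cat_edge_sym : symmetric cat_edge.
Proof. by move=> [a|s] [c|s'] //=; rewrite orbC. Qed.

Lemma cat_edge_irrefl : irreflexive cat_edge.
Proof. by move=> [a|s] //=; rewrite orbb; apply/eqP => /esym /n_Sn. Qed.

Definition caterpillar : sgraph := SGraph cat_edge_sym cat_edge_irrefl.

End Caterpillar.

(* T(m_l - 2, m_(l-1) - 2, ..., m_2 - 2). In a tree eccentric sequence of more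
   than two vertices, m_j >= 2 for 2 <= j <= l, so the subtraction does not
   truncate, and ceil((b_l - 1) / 2) = l - 1. *)
Definition min_tree (l : nat) (b m : nat -> nat) : sgraph :=
  caterpillar (b l - 1) (fun j => m (l + 1 - j) - 2).

(* Main.v *)
Require Import Defs.
From HB Require Import structures.
From mathcomp Require Import all_boot all_order all_algebra.
From mathcomp Require Import zify.
Import Order.TTheory GRing.Theory Num.Theory.

Set Implicit Arguments.
Unset Strict Implicit.
Unset Printing Implicit Defensive.

(** Fix a diametral path of length [D] in the tree.  A vertex attached at the
    path vertex number [f], at height [h] above it, has eccentricity
    [h + max f (D - f)].  Map each path vertex to itself and each off-path
    vertex of eccentricity [D + 1 - k] to a pendant vertex attached at [v_k].
    Going from the caterpillar back to the tree, the total distance of an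
    off-path vertex of height [h] to the path grows by
    [(h - 1) (2 k + h) >= 4 (h - 1)], and the distance of two off-path vertices
    drops only if one is an ancestor of the other, and then by 2; since a vertex
    of height [h] has at most [h - 1] off-path ancestors, the Wiener index
    does not drop.  In case of equality all heights are 1 and all pendant
    vertices hang on the same half of the path, so the tree is the
    caterpillar. *)

(** * Distances in trees *)

Lemma has_pathP (G : sgraph) (x y : G) n :
  reflect (exists p : seq G,
             [/\ path (@edge G) x p, uniq (x :: p), last x p = y & size p = n])
          (has_path_of_length x y n).
Proof.
apply: (iffP existsP) => [[p /and3P[xp up /eqP lp]]|[p [xp up lp sp]]].
  by exists p; split=> //; rewrite size_tuple.
have sp' : size p == n by rewrite sp.
by exists (Tuple sp'); rewrite /= xp lp eqxx andbT; exact: up.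
Qed.

Lemma path_length_lt (G : sgraph) (x y : G) n :
  has_path_of_length x y n -> n < #|G|.
Proof. case/has_pathP=> p [_ up _ <-].
by apply: leq_trans (max_card (mem (x :: p))); rewrite (card_uniqP up). Qed.

Lemma dist_le (G : sgraph) (x y : G) n : has_path_of_length x y n -> dist x y <= n.
Proof.
move=> hp; rewrite leqNgt; apply/negP => /(before_find 0).
by rewrite nth_iota ?add0n ?hp //; apply: path_length_lt hp.
Qed.

Lemma dist_path (G : sgraph) (x y : G) :
  dist x y < #|G| -> has_path_of_length x y (dist x y).
Proof.
move=> lt; have hs : has (has_path_of_length x y) (iota 0 #|G|).
  by rewrite has_find size_iota.
by have := nth_find 0 hs; rewrite nth_iota.
Qed.

(** The growth condition makes every path from [x] to [y] at least [f y] long, and descending one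
    unit at a time builds a walk of exactly that length. The metrics of trees and of caterpillars
    are both computed through this criterion. *)
Lemma dist_charact (G : sgraph) (x : G) (f : G -> nat) :
  f x = 0 -> (forall y, f y = 0 -> y = x) ->
  (forall u v, edge u v -> f v <= (f u).+1) ->
  (forall y n, f y = n.+1 -> exists2 z, edge z y & f z = n) ->
  forall y, dist x y = f y.
Proof.
move=> fx f0 fE fS y.
have lb p : path (@edge G) x p -> f (last x p) <= size p.
  elim/last_ind: p => [|p z IH] /=; first by rewrite fx.
  rewrite rcons_path last_rcons size_rcons => /andP[/IH lep /fE lez].
  by apply: leq_trans lez _; rewrite ltnS.
have ex : exists p, [/\ path (@edge G) x p, last x p = y & size p = f y].
  move: {2}(f y) (erefl (f y)) => n; elim: n y => [|n IH] y fy.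
    by exists [::]; rewrite fy /= (f0 _ fy).
  have [z zy fz] := fS _ _ fy; have [p [xp lp sp]] := IH _ fz.
  by exists (rcons p y); rewrite rcons_path xp lp zy last_rcons size_rcons sp fz.
have hp : has_path_of_length x y (f y).
  case: ex => p [xp lp sp]; move: lp.
  (* The walk may repeat vertices; its shortening is no longer, and [lb] keeps it from being
     shorter. *)
  case: (shortenP xp) => p' xp' up' sub lp; apply/has_pathP.
  exists p'; split=> //; apply/eqP; rewrite eqn_leq -{2}lp lb // andbT -sp.
  by apply: uniq_leq_size => //; case/andP: up'.
have le := dist_le hp; apply/eqP; rewrite eqn_leq le /=.
have /has_pathP[p [xp _ lp <-]] := dist_path (leq_ltn_trans le (path_length_lt hp)).
by rewrite -lp lb.
Qed.

(** This lets a distance-preserving bijection be recognised as an isomorphism. *)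
Lemma dist1_edge (G : sgraph) (x y : G) : (dist x y == 1) = edge x y.
Proof.
apply/eqP/idP => [d1|xy].
  have [lt|le1] := ltnP 1 #|G|.
    have := @dist_path _ x y; rewrite d1 => /(_ lt) /has_pathP[[|z [|? ?]]] [] //=.
    by rewrite andbT => xz _ <- _.
  have /dist_le : has_path_of_length x y 0; last by rewrite d1.
  apply/has_pathP; exists [::]; split=> //=.
  by apply: (card_le1_eqP le1).
have nxy : x != y by apply: contraTneq xy => ->; rewrite edge_irrefl.
have hp : has_path_of_length x y 1.
  by apply/has_pathP; exists [:: y]; rewrite /= xy inE nxy.
have le := dist_le hp; apply/eqP; rewrite eqn_leq le lt0n /=.
apply: contraNneq nxy => d0.
have := dist_path (leq_ltn_trans le (path_length_lt hp)).
by rewrite d0 => /has_pathP[[|? ?] [] //= _ _ -> _].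
Qed.

(** Sums over ordered pairs can be reindexed along a bijection without regard to the order on
    [enum_rank]. *)
Lemma wiener_double (G : sgraph) :
  (forall x : G, dist x x = 0) -> (forall x y : G, dist x y = dist y x) ->
  2 * Wiener G = \sum_(u : G) \sum_(v : G) dist u v.
Proof.
move=> d0 dC.
have -> : \sum_(u : G) \sum_(v : G) dist u v =
    Wiener G + \sum_(u : G) \sum_(v : G | enum_rank v < enum_rank u) dist u v.
  rewrite -big_split; apply: eq_bigr => u _ /=.
  rewrite (bigID (fun v : G => enum_rank u < enum_rank v)) /=; congr (_ + _).
  rewrite (bigD1 u) /= ?ltnn // d0 add0n; apply: eq_bigl => v.
  rewrite -leqNgt [in RHS]ltn_neqAle andbC; congr (~~ _ && _).
  by rewrite -(inj_eq enum_rank_inj).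
rewrite mul2n -addnn; congr (_ + _); rewrite [RHS](exchange_big_dep predT) //=.
by apply: eq_bigr => u _; apply: eq_bigr => v _; rewrite dC.
Qed.

(** If the paths leave [x] through different neighbours [a] and [b], their tails connect [a] to [b]
    without [x]; closing up through [x] gives a cycle. *)
Lemma acyclic_uniq_path (G : sgraph) (x : G) (s1 s2 : seq G) : acyclic G ->
  path (@edge G) x s1 -> uniq (x :: s1) ->
  path (@edge G) x s2 -> uniq (x :: s2) ->
  last x s1 = last x s2 -> s1 = s2.
Proof.
move=> aG; elim: s1 x s2 => [|a s1 IH] x [|b s2] //.
- by move=> _ _ _ /andP[xb _] /= e; rewrite e mem_last in xb.
- by move=> _ /andP[xb _] _ _ /= e; rewrite -e mem_last in xb.
move=> /= /andP[xa pa] /andP[xs1 u1] /andP[xb pb] /andP[xs2 u2] e.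
have [ab|nab] := eqVneq a b.
  by subst b; congr (_ :: _); apply: (IH a).
(* Adjacency in the graph with [x] deleted. *)
pose e' := [rel u v : G | [&& edge u v, u != x & v != x]].
have e'sym : connect_sym e'.
  by apply: sym_connect_sym => u v; rewrite /= edge_sym; congr (_ && _); rewrite andbC.
have conn c s : path (@edge G) c s -> x \notin c :: s -> connect e' c (last c s).
  move=> ps xs; apply/connectP; exists s => //.
  elim: s c ps xs => //= d s IHs c /andP[cd ds].
  rewrite !inE !negb_or => /and3P[xc xd xs]; rewrite cd eq_sym xc eq_sym xd /=.
  by apply: IHs => //; rewrite inE negb_or xd.
have /connectP[p pp lp] : connect e' a b.
  apply: connect_trans (conn _ _ pa xs1) _.
  by rewrite e e'sym; apply: conn.
move: lp; case: (shortenP pp) => p' pp' up' _ lp.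
have xp' : x \notin a :: p'.
  rewrite inE negb_or; apply/andP; split.
    by apply: contraNneq xs1 => ->; rewrite mem_head.
  elim: p' (a) pp' {up' lp} => //= d s IHs c /andP[/and3P[_ _ dx]] /IHs.
  by rewrite inE negb_or eq_sym dx.
case: (aG (x :: a :: p')); first by case: (p') lp => [|? ?] //= eba; rewrite eba eqxx in nab.
apply/andP; split; last by rewrite cons_uniq xp'.
rewrite (cycle_path x) /= -lp edge_sym xb xa /=.
by apply: sub_path pp' => u v /= /and3P[].
Qed.

(** * Longest common prefixes and the distance between words *)

Section CommonPrefix.
Variable T : eqType.
Implicit Types s t u : seq T.

Fixpoint lcp s t : nat :=
  match s, t with
  | a :: s', b :: t' => if a == b then (lcp s' t').+1 else 0
  | _, _ => 0
  end.

Lemma lcpC s t : lcp s t = lcp t s.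
Proof. by elim: s t => [|a s IH] [|b t] //=; rewrite eq_sym IH. Qed.

Lemma lcp_sizel s t : lcp s t <= size s.
Proof. by elim: s t => [|a s IH] [|b t] //=; case: ifP => // _; apply: IH. Qed.

Lemma lcp_prefix s t : lcp s t = size s -> exists u, t = s ++ u.
Proof.
elim: s t => [|a s IH] [|b t] //=; first by exists [::].
  by exists (b :: t).
by case: eqP => // <- [/IH[u ->]]; exists u.
Qed.

Lemma lcp_cat s t : lcp s (s ++ t) = size s.
Proof. by elim: s => [|a s IH] /=; rewrite ?eqxx ?IH //; case: t. Qed.

Lemma lcp_refl s : lcp s s = size s.
Proof. by rewrite -{2}[s]cats0 lcp_cat. Qed.

Lemma lcp_rcons s t a : lcp s t <= lcp s (rcons t a) <= (lcp s t).+1.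
Proof.
elim: s t => [|b s IH] [|c t] //=; first by case: ifP => // _; case: (s).
by case: ifP => // _; rewrite !ltnS IH.
Qed.

Lemma lcp_rcons_lt s t a : lcp s (rcons t a) <= size t ->
  lcp s (rcons t a) = lcp s t.
Proof.
elim: s t => [|b s IH] [|c t] //=; first by case: ifP.
by case: ifP => // _; rewrite ltnS => /IH ->.
Qed.

(** A prefix shared with [t] by both [s] and [u] is common to [s] and [u]. This ultrametric
    inequality is the source of the four-point condition. *)
Lemma lcp_ultra s t u : minn (lcp s t) (lcp t u) <= lcp s u.
Proof.
elim: s t u => [|a s IH] [|b t] [|c u] //=; rewrite ?min0n ?minn0 //.
case: (eqVneq a b) => [->|_]; last by rewrite min0n.
by case: ifP => // _; rewrite ?minn0 // minnSS ltnS IH.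
Qed.

(* Distance between the nodes [s] and [t] of the prefix tree. *)
Definition prefix_dist s t := size s + size t - 2 * lcp s t.

(** The common prefix is no longer than either word, so the subtraction in [prefix_dist] does not
    truncate. *)
Lemma prefix_dist_lcp s t : prefix_dist s t + 2 * lcp s t = size s + size t.
Proof.
by rewrite /prefix_dist; have := lcp_sizel s t; have := lcp_sizel t s; rewrite lcpC; lia.
Qed.

Lemma prefix_distC s t : prefix_dist s t = prefix_dist t s.
Proof. by rewrite /prefix_dist addnC lcpC. Qed.

Lemma prefix_distxx s : prefix_dist s s = 0.
Proof. by have := prefix_dist_lcp s s; rewrite lcp_refl; lia. Qed.

Lemma prefix_dist0s t : prefix_dist [::] t = size t.
Proof. by rewrite /prefix_dist /= subn0. Qed.

Lemma prefix_dist_cat s t : prefix_dist s (s ++ t) = size t.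
Proof. by have := prefix_dist_lcp s (s ++ t); rewrite lcp_cat size_cat; lia. Qed.

Lemma prefix_dist_eq0 s t : prefix_dist s t = 0 -> s = t.
Proof.
move=> d0; have := prefix_dist_lcp s t; have := lcp_sizel s t.
have := lcp_sizel t s; rewrite lcpC d0 => l1 l2 e.
have [|[|a w] et] := @lcp_prefix s t; [by lia|by rewrite et cats0|].
by move: d0; rewrite et prefix_dist_cat.
Qed.

Lemma prefix_dist_rcons s t a :
  prefix_dist s (rcons t a) <= (prefix_dist s t).+1 /\
  prefix_dist s t <= (prefix_dist s (rcons t a)).+1.
Proof.
have := prefix_dist_lcp s t; have := prefix_dist_lcp s (rcons t a).
by rewrite size_rcons; have := lcp_rcons s t a; lia.
Qed.

(** One step from [t] towards [s]: if [t] is a prefix of [s], append the next letter of [s];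
    otherwise drop the last letter of [t]. *)
Lemma prefix_dist_step s t n : prefix_dist s t = n.+1 ->
  (exists a u, s = rcons t a ++ u /\ prefix_dist s (rcons t a) = n) \/
  (exists t' a, t = rcons t' a /\ prefix_dist s t' = n).
Proof.
move=> dn; have := lcp_sizel t s; rewrite leq_eqVlt => /orP[/eqP ets|lt].
  have [[|a u] es] := lcp_prefix ets.
    by move: dn; rewrite es cats0 prefix_distxx.
  left; exists a, u; rewrite cat_rcons; split=> //.
  move: dn; rewrite es prefix_distC prefix_dist_cat => -[<-].
  by rewrite -cat_rcons prefix_distC prefix_dist_cat.
right; case: (lastP t) dn lt => [|t' a] dn; first by [].
rewrite size_rcons ltnS lcpC => lt; exists t', a; split=> //.
move: dn; rewrite /prefix_dist (lcp_rcons_lt lt) size_rcons.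
by have := prefix_dist_lcp s t'; lia.
Qed.

End CommonPrefix.

(** * Trees as prefix trees of root paths *)

Section RootedTree.
Variables (G : sgraph) (treeG : is_tree G) (p : G).

Definition rooted_path (x : G) (s : seq G) :=
  [&& path (@edge G) p s, uniq (p :: s) & last p s == x].

Lemma rooted_path_ex x : exists s, rooted_path x s.
Proof.
have [[_ /(_ p x) /connectP[s ps lx]] _] := treeG.
move: lx; case: (shortenP ps) => s' ps' us' _ ->.
by exists s'; rewrite /rooted_path ps' us' eqxx.
Qed.

Definition root_path x : seq G := xchoose (rooted_path_ex x).

Lemma root_pathE x s : rooted_path x s -> root_path x = s.
Proof.
case/and3P=> ps us /eqP lx; have /and3P[pr ur /eqP lr] := xchooseP (rooted_path_ex x).
by have [_ aG] := treeG; apply: (acyclic_uniq_path aG pr ur ps us); rewrite lr lx.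
Qed.

Lemma root_pathP x : rooted_path x (root_path x).
Proof. exact: xchooseP. Qed.

Lemma root_path_root : root_path p = [::].
Proof. by apply: root_pathE; rewrite /rooted_path /= eqxx. Qed.

Lemma root_path_inj : injective root_path.
Proof.
move=> x y e; have /and3P[_ _ /eqP <-] := root_pathP x.
by rewrite e; have /and3P[_ _ /eqP] := root_pathP y.
Qed.

Lemma root_path_cat x s1 s2 : root_path x = s1 ++ s2 ->
  root_path (last p s1) = s1.
Proof.
move=> e; apply: root_pathE; have := root_pathP x; rewrite e /rooted_path eqxx.
by rewrite cat_path -cat_cons cat_uniq => /and3P[/andP[-> _] /andP[-> _] _].
Qed.

(** If [v] is not on the path from the root to [u], that path extends by [v]. Otherwise its initial
    part up to [v] is the root path of [v]; it misses [u], hence extends by [u]. *)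
Lemma root_path_edge u v : edge u v ->
  root_path v = rcons (root_path u) v \/ root_path u = rcons (root_path v) u.
Proof.
move=> uv; have /and3P[pu uu /eqP lu] := root_pathP u.
have ext a b : edge a b -> b \notin p :: root_path a ->
    root_path b = rcons (root_path a) b.
  move=> ab nb; apply: root_pathE; have /and3P[pa ua /eqP la] := root_pathP a.
  rewrite /rooted_path rcons_path pa la ab last_rcons eqxx andbT -rcons_cons.
  by rewrite rcons_uniq nb ua.
have [vu|] := boolP (v \in p :: root_path u); last by left; apply: ext.
right; apply: ext; first by rewrite edge_sym.
case/splitPl e: {1}(root_path u) / vu => [p1 p2 lv].
have := root_path_cat e; rewrite lv => ->.
move: uu lu; rewrite e last_cat -cat_cons cat_uniq lv => /and3P[_ /hasPn dis _].
case: (lastP p2) dis => [|p2' z] dis; first by move=> /= vu'; rewrite vu' edge_irrefl in uv.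
by rewrite last_rcons => <-; apply: dis; rewrite mem_rcons mem_head.
Qed.

Lemma root_path_rcons x s z : root_path x = rcons s z ->
  x = z /\ edge (last p s) z.
Proof.
move=> e; have := root_pathP x; rewrite e /rooted_path last_rcons rcons_path.
by case/and3P=> /andP[_ ->] _ /eqP ->.
Qed.

(** Moving along an edge adds or removes one last letter of the root path, so the prefix distance
    meets the conditions of [dist_charact]. *)
Lemma tree_distE x y : dist x y = prefix_dist (root_path x) (root_path y).
Proof.
apply: (@dist_charact G x (fun y => prefix_dist (root_path x) (root_path y))) => {y}.
- exact: prefix_distxx.
- by move=> y /prefix_dist_eq0/root_path_inj.
- move=> u v /root_path_edge[] ->.
    by case: (prefix_dist_rcons (root_path x) (root_path u) v).
  by case: (prefix_dist_rcons (root_path x) (root_path v) u).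
move=> y n /prefix_dist_step[[z [w [ex <-]]]|[s [z [ey <-]]]].
  have ez := root_path_cat ex; rewrite last_rcons in ez.
  have [_] := root_path_rcons ez; have /and3P[_ _ /eqP ->] := root_pathP y => yz.
  by exists z; rewrite 1?edge_sym // ez.
have [yz sz] := root_path_rcons ey; subst z.
exists (last p s) => //.
by rewrite (@root_path_cat y s [:: y]) // cats1.
Qed.

End RootedTree.

(** * Gromov products and the four-point condition *)

Section TreeMetric.
Variables (G : sgraph) (treeG : is_tree G).
Implicit Types p x y z : G.

(** [g] is the Gromov product based at [p], that is, the depth at which the root paths of [x] and
    [y] separate. *)
Lemma tree_gromov p : exists g : G -> G -> nat,
  [/\ forall x y, dist x y + 2 * g x y = dist p x + dist p y,
      forall x y, g x y = g y x
    & forall x y z, minn (g x y) (g y z) <= g x z].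
Proof.
exists (fun x y => lcp (root_path treeG p x) (root_path treeG p y)).
split=> [x y|x y|x y z]; [|exact: lcpC|exact: lcp_ultra].
by rewrite !(tree_distE treeG p) prefix_dist_lcp root_path_root !prefix_dist0s.
Qed.

Lemma tree_distC x y : dist x y = dist y x.
Proof. by have [g [e gC _]] := tree_gromov x; have := e x y; have := e y x; rewrite gC; lia. Qed.

Lemma tree_distxx x : dist x x = 0.
Proof. by rewrite (tree_distE treeG x) prefix_distxx. Qed.

Lemma tree_dist_eq0 x y : dist x y = 0 -> x = y.
Proof. by rewrite (tree_distE treeG x) => /prefix_dist_eq0/root_path_inj. Qed.

(** The evenness makes the halvings in [height] and [foot] exact. *)
Lemma tree_parity x y z : exists g, dist x y + 2 * g = dist z x + dist z y.
Proof. by have [g [e _ _]] := tree_gromov z; exists (g x y). Qed.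

Lemma tree_triangle z x y : dist x y <= dist x z + dist z y.
Proof. by have [g] := tree_parity x y z; rewrite (tree_distC x z); lia. Qed.

Lemma tree_four_point p x y z :
  dist x z + dist p y <= maxn (dist x y + dist p z) (dist y z + dist p x).
Proof.
have [g [e gC ul]] := tree_gromov p.
by have := ul x y z; have := e x z; have := e x y; have := e y z; lia.
Qed.

(** With the tree rooted at [x], the witness is the vertex at depth [i] on the root path of [y]. *)
Lemma tree_between x y i : i <= dist x y ->
  exists z, dist x z = i /\ dist z y = dist x y - i.
Proof.
rewrite !(tree_distE treeG x) root_path_root prefix_dist0s => le.
pose s := root_path treeG x y.
have es : root_path treeG x (last x (take i s)) = take i s.
  by apply: (@root_path_cat _ treeG _ y _ (drop i s)); rewrite cat_take_drop.
exists (last x (take i s)).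
rewrite !(tree_distE treeG x) root_path_root es -/s prefix_dist0s size_takel //.
by rewrite -{2}(cat_take_drop i s) prefix_dist_cat size_drop.
Qed.

End TreeMetric.

(** * Caterpillars and diametral paths *)

Section CaterpillarDistance.
Variables (q : nat) (t : nat -> nat).
Implicit Types u v w : caterpillar q t.

Definition cat_pos (u : caterpillar q t) : nat :=
  match u with inl a => a | inr s => (tag s).+1 end.

Definition cat_leaf (u : caterpillar q t) : nat :=
  match u with inl _ => 0 | inr _ => 1 end.

Definition cat_dist u v : nat :=
  if u == v then 0
  else (cat_pos u - cat_pos v) + (cat_pos v - cat_pos u) + cat_leaf u + cat_leaf v.

Lemma tag_pos_lt (s : {j : 'I_(uphalf q) & 'I_(t j.+1)}) : (tag s).+1 < q.+2.
Proof. by have := ltn_ord (tag s); lia. Qed.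

Lemma cat_distE u v : dist u v = cat_dist u v.
Proof.
apply: (@dist_charact _ u (cat_dist u)) => {v}.
- by rewrite /cat_dist eqxx.
- move=> v; rewrite /cat_dist; case: eqVneq => // nuv.
  case: u v nuv => [a|s] [c|s'] //= nuv; try lia.
  by move=> e; case/eqP: nuv; congr inl; apply: val_inj => /=; lia.
- move=> v w vw; rewrite /cat_dist.
  case: (eqVneq u w) => // _; case: (eqVneq u v) => [->|_].
    by case: v w vw => [a|s] [c|s'] //=; lia.
  by case: v w vw => [a|s] [c|s'] //=; lia.
move=> v n; rewrite /cat_dist; case: (eqVneq u v) => // nuv.
(* A pendant vertex is entered from its attachment vertex. A path vertex is entered from its
   neighbour on the side of [u], or from [u] itself if [u] is a pendant attached there. *)
case: v nuv => [c|s] nuv /= dn; last first.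
  exists (inl (Ordinal (tag_pos_lt s))) => /=; first exact: eqxx.
  by case: eqP => [eu|_] /=; rewrite ?eu /= in dn *; lia.
have [lt|gt|e] := ltngtP (cat_pos u) c.
- have lc : c.-1 < q.+2 by have := ltn_ord c; lia.
  exists (inl (Ordinal lc)) => /=; first by apply/orP; lia.
  by case: eqP => [eu|_] /=; rewrite ?eu /= in dn *; lia.
- have lc : c.+1 < q.+2.
    by case: (u) gt => [a|s] /=; [have := ltn_ord a|have := tag_pos_lt s]; lia.
  exists (inl (Ordinal lc)) => /=; first by apply/orP; lia.
  by case: eqP => [eu|_] /=; rewrite ?eu /= in dn *; lia.
case: u nuv dn e => [a|s] nuv dn e.
  by case/eqP: nuv; congr inl; apply: val_inj.
by exists (inr s); rewrite /= ?eqxx -?e //=; move: dn e => /=; lia.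
Qed.

Lemma cat_distC u v : dist u v = dist v u.
Proof.
rewrite !cat_distE /cat_dist eq_sym; case: eqP => // _.
by rewrite [X in X + _ + _]addnC addnAC.
Qed.

End CaterpillarDistance.

(** * Coordinates relative to a diametral path *)

Section Diametral.
Variables (G : sgraph) (treeG : is_tree G) (x0 xD : G).
Local Notation D := (dist x0 xD).
Hypothesis diam : forall x y : G, dist x y <= D.
Implicit Types x y z : G.

(* [x] hangs at height [height x] above the vertex number [foot x] of the path
   from [x0] to [xD]. *)
Definition height x := (dist x0 x + dist x xD - D)./2.
Definition foot x := (dist x0 x + D - dist x xD)./2.

(** The last two bounds restate that [xD] and [x0] are within [D] of [x]: a branch is no longer than
    either part of the path at its foot. *)
Lemma foot_height x :
  [/\ dist x0 x = foot x + height x, dist x xD + foot x = height x + D,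
      height x <= foot x & foot x + height x <= D].
Proof.
have [g] := tree_parity treeG x0 xD x; rewrite (tree_distC treeG x x0).
have := tree_triangle treeG xD x0 x; have := tree_triangle treeG x x0 xD.
have := tree_triangle treeG x0 x xD; have := diam x0 x; have := diam x xD.
rewrite (tree_distC treeG xD x) (tree_distC treeG x x0) /foot /height.
by move=> d1 d2 t1 t2 t3 e; split; lia.
Qed.

(** The default [x0] is never taken for [i <= D], the only range used. *)
Definition spine i : G :=
  odflt x0 [pick z | (dist x0 z == i) && (dist z xD == D - i)].

Lemma spineP i : i <= D -> dist x0 (spine i) = i /\ dist (spine i) xD = D - i.
Proof.
move=> le; rewrite /spine; case: pickP => [z /andP[/eqP ? /eqP ?]|] //=.
by have [z [e1 e2]] := tree_between treeG le => /(_ z); rewrite e1 e2 !eqxx.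
Qed.

Lemma spine_foot i : i <= D -> foot (spine i) = i /\ height (spine i) = 0.
Proof. by move=> /[dup] le /spineP[]; rewrite /foot /height => -> ->; lia. Qed.

Lemma dist_foot x y : foot x != foot y ->
  dist x y = height x + height y + (foot x - foot y) + (foot y - foot x).
Proof.
have [a1 b1 c1 d1] := foot_height x; have [a2 b2 c2 d2] := foot_height y => ne.
have := tree_four_point treeG x y x0 xD; have := tree_four_point treeG y x x0 xD.
have := tree_four_point treeG x x0 y xD; have := tree_four_point treeG x0 x xD y.
rewrite !(tree_distC treeG _ x0) !(tree_distC treeG xD) (tree_distC treeG y x).
by move=> f1 f2 f3 f4; lia.
Qed.

(** [c] is the length of the common part of the two branches. It is the Gromov product at [x0] minus
    the distance from [x0] to the common foot. *)
Lemma dist_same_foot x y : foot x = foot y -> exists c,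
  [/\ dist x y + 2 * c = height x + height y, c <= height x & c <= height y].
Proof.
have [a1 b1 c1 d1] := foot_height x; have [a2 b2 c2 d2] := foot_height y => e.
have [g] := tree_parity treeG x y x0.
have := tree_triangle treeG x x0 y; have := tree_triangle treeG y x0 x.
have := tree_triangle treeG x xD y; have := tree_triangle treeG y xD x.
have := tree_four_point treeG x y x0 xD; have := tree_four_point treeG y x x0 xD.
have := tree_four_point treeG x x0 y xD; have := tree_four_point treeG x0 x xD y.
rewrite !(tree_distC treeG _ x0) !(tree_distC treeG xD) (tree_distC treeG y x).
by move=> f1 f2 f3 f4 t1 t2 t3 t4 eg; exists (g - foot x); split; lia.
Qed.

Lemma dist_spine x i : i <= D ->
  dist x (spine i) = height x + (foot x - i) + (i - foot x).
Proof.
move=> /spine_foot[fi hi]; have [e|ne] := eqVneq (foot x) (foot (spine i)).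
  by have [c []] := dist_same_foot e; rewrite hi; lia.
by rewrite dist_foot // fi hi addn0.
Qed.

Lemma height0_spine x : height x = 0 -> x = spine (foot x).
Proof.
move=> hx; have [_ _ _ le] := foot_height x; apply: (tree_dist_eq0 treeG).
by rewrite dist_spine ?hx; lia.
Qed.

(** By the four-point condition an end of the diametral path is farthest from [x]. *)
Lemma eccE x : ecc x = height x + maxn (foot x) (D - foot x).
Proof.
have [a1 b1 c1 d1] := foot_height x.
apply/eqP; rewrite eqn_leq; apply/andP; split; last first.
  have l1 : dist x x0 <= ecc x := leq_bigmax x0.
  have l2 : dist x xD <= ecc x := leq_bigmax xD.
  by rewrite (tree_distC treeG x x0) in l1; lia.
apply/bigmax_leqP => y _; have [a2 b2 c2 d2] := foot_height y.
have := tree_four_point treeG x0 x xD y.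
by rewrite (tree_distC treeG xD y); lia.
Qed.

(** Metric form of: [y] lies strictly between [x] and the path on the branch leading to [x]. *)
Definition ancestor y x :=
  [&& foot y == foot x, 0 < height y, height y < height x
    & dist x y + height y == height x].

Lemma ancestor_inj x y z :
  ancestor y x -> ancestor z x -> height y = height z -> y = z.
Proof.
case/and4P=> /eqP fy hy lty /eqP dy /and4P[/eqP fz hz ltz /eqP dz] e.
have [_ _ _ le] := foot_height x.
have fxD : foot x <= D by lia.
have sx := dist_spine x fxD; have sy := dist_spine y fxD; have sz := dist_spine z fxD.
have := tree_four_point treeG y x z (spine (foot x)); rewrite (tree_distC treeG y x).
by move=> f; apply: (tree_dist_eq0 treeG); lia.
Qed.

(** The heights of the ancestors of [x] are distinct and lie between 1 and [height x - 1]. *)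
Lemma card_ancestor x : #|[pred y | ancestor y x]| <= (height x).-1.
Proof.
rewrite cardE -(size_map height) -(size_iota 1 (height x).-1).
apply: uniq_leq_size.
  rewrite map_inj_in_uniq ?enum_uniq // => y z.
  by rewrite !mem_enum; apply: ancestor_inj.
move=> _ /mapP[y /[!mem_enum] /and4P[_ h1 h2 _] ->].
by rewrite mem_iota; lia.
Qed.

(** The left side will be the distance of the matching pendants in the caterpillar. With distinct
    feet both heights count in full. With a common foot the bound fails only if the common part is
    the whole lower branch, whose end is then an ancestor. *)
Lemma dist_off_lower x y : 0 < height x -> 0 < height y -> x != y ->
  (ecc x - ecc y) + (ecc y - ecc x) + 2 <=
    dist x y + 2 * ancestor x y + 2 * ancestor y x.
Proof.
move=> hx hy nxy; rewrite !eccE.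
have [a1 b1 c1 d1] := foot_height x; have [a2 b2 c2 d2] := foot_height y.
have [e|ne] := eqVneq (foot x) (foot y); last by rewrite (dist_foot ne); lia.
have d0 : dist x y <> 0.
  by move=> d0; rewrite (tree_dist_eq0 treeG d0) eqxx in nxy.
have [c [ec lx ly]] := dist_same_foot e.
rewrite /ancestor e eqxx hx hy (tree_distC treeG y x) /=.
by case: ltngtP; case: eqP; case: eqP; lia.
Qed.

End Diametral.

(** * Comparing a tree with its caterpillar *)

Lemma sum_le_pointwise_eq (I : finType) (E F : I -> nat) :
  (forall i, E i <= F i) -> \sum_i F i <= \sum_i E i -> forall i, E i = F i.
Proof.
move=> le les i; apply/eqP; rewrite eqn_leq le /=; move: les.
rewrite (bigD1 i) //= [leqRHS](bigD1 i) //=.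
have : \sum_(j | j != i) E j <= \sum_(j | j != i) F j by apply: leq_sum.
by lia.
Qed.

(** Fibres of equal size are matched rank by rank in their enumerations. *)
Lemma fiber_inj (A B : finType) (f : A -> nat) (g : B -> nat) :
  (forall k, #|[pred a | f a == k]| = #|[pred b | g b == k]|) ->
  exists2 phi : B -> A, injective phi & forall b, f (phi b) = g b.
Proof.
move=> card_eq.
pose fa k := enum [pred a | f a == k]; pose gb k := enum [pred b | g b == k].
have mem_gb b : b \in gb (g b) by rewrite mem_enum inE.
have lt b : index b (gb (g b)) < size (fa (g b)).
  by rewrite -cardE card_eq cardE index_mem.
(* Only a default for [nth]; the index is always in range. *)
pose d b := tnth (in_tuple (fa (g b))) (Ordinal (lt b)).
pose phi b := nth (d b) (fa (g b)) (index b (gb (g b))).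
have phif b : f (phi b) = g b.
  by have := mem_nth (d b) (lt b); rewrite mem_enum inE => /eqP.
exists phi => // b b' e; have gg : g b = g b' by rewrite -!phif e.
have ei : index b (gb (g b)) = index b' (gb (g b')).
  rewrite -(@index_uniq _ (d b) (index b _) (fa (g b))) ?enum_uniq //.
  rewrite -(@index_uniq _ (d b') (index b' _) (fa (g b'))) ?enum_uniq //.
  by rewrite -/(phi b) -/(phi b') e gg.
by rewrite -(nth_index b (mem_gb b)) ei gg nth_index.
Qed.

Lemma fiber_bij (A B : finType) (f : A -> nat) (g : B -> nat) :
  (forall k, #|[pred a | f a == k]| = #|[pred b | g b == k]|) ->
  exists2 phi : B -> A, bijective phi & forall b, f (phi b) = g b.
Proof.
move=> card_eq; have [phi phi_inj phif] := fiber_inj card_eq.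
have [psi psi_inj _] := fiber_inj (fun k => esym (card_eq k)).
by exists phi => //; apply: inj_card_bij => //; apply: leq_card psi_inj.
Qed.

Lemma bin2_double n : 2 * 'C(n.+1, 2) = n * n.+1.
Proof. by elim: n => // n IH; rewrite binS bin1; lia. Qed.

Lemma sum_dist_path j n : j <= n ->
  \sum_(i < n.+1) ((j - i) + (i - j)) = 'C(j.+1, 2) + 'C((n - j).+1, 2).
Proof.
elim: j n => [|j IH] [|n] // lt.
- by rewrite big_ord_recl big_ord0.
- rewrite -(big_mkord predT (fun i => (0 - i) + (i - 0))) add0n -bin2_sum.
  by apply: eq_bigr => i _; rewrite subn0.
rewrite big_ord_recl /= subn0 addn0 (eq_bigr (fun i : 'I_ _ => (j - i) + (i - j))).
  by rewrite IH // subSS [in RHS]binS bin1; lia.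
by move=> i _; rewrite /bump /= !subSS.
Qed.

(* Raising the attachment point by [g] and the height of a vertex by [g] keeps
   its eccentricity, but moves it away from the path in total. *)
Lemma sum_dist_path_shift a g f n : f <= n -> minn f (n - f) = (a + g).+1 ->
  \sum_(i < n.+1) ((a.+1 - i) + (i - a.+1) + 1) + 4 * g <=
  \sum_(i < n.+1) (g.+1 + ((f - i) + (i - f))).
Proof.
move=> le ef; rewrite [X in X + _ <= _]big_split [leqRHS]big_split /=.
rewrite !sum_dist_path ?sum_nat_const ?card_ord //; last by lia.
have := bin2_double a.+1; have := bin2_double (n - a.+1).
have := bin2_double f; have := bin2_double (n - f).
(* The exact gain is g (2 a + g + 3), and this is at least 4 g because g * g >= g. *)
move=> b1 b2 b3 b4; have gg : g <= g * g by case: (g) => // k; rewrite leq_pmulr.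
have [lef|gtf] := leqP f (n - f).
  have [e1 e2] : f = (a + g).+1 /\ n - a.+1 = n - f + g by lia.
  have en : n = f + (n - f) by lia.
  move: b1 b2 b3 b4; rewrite e2 [in n.+1]en; move: (n - f) => e.
  by rewrite e1; lia.
have [e1 e2] : n - f = (a + g).+1 /\ n - a.+1 = f + g by lia.
have en : n = f + (n - f) by lia.
by move: b1 b2 b3 b4; rewrite e2 [in n.+1]en e1; lia.
Qed.

Lemma sum_sym_sumType (I J : finType) (F : I + J -> I + J -> nat) :
  (forall u v, F u v = F v u) ->
  \sum_u \sum_v F u v =
    \sum_i \sum_j F (inl i) (inl j) + 2 * \sum_s \sum_i F (inr s) (inl i)
    + \sum_s \sum_s' F (inr s) (inr s').
Proof.
move=> FC; rewrite big_sumType /=.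
under eq_bigr do rewrite big_sumType /=.
under [X in _ + X]eq_bigr do rewrite big_sumType /=.
rewrite !big_split /= mul2n -addnn !addnA; congr (_ + _ + _ + _).
by rewrite exchange_big /=; apply: eq_bigr => s _; apply: eq_bigr => i _.
Qed.

Lemma sum_sym_correction (I : finType) (F A : I -> I -> nat) :
  \sum_s \sum_s' (F s s' + 2 * (A s s' + A s' s)) =
    \sum_s \sum_s' F s s' + 4 * \sum_s \sum_s' A s s'.
Proof.
have -> : 4 * \sum_s \sum_s' A s s' =
    2 * (\sum_s \sum_s' A s s' + \sum_s \sum_s' A s' s).
  by rewrite [X in _ + X]exchange_big /=; lia.
rewrite -big_split big_distrr -big_split /=; apply: eq_bigr => s _.
by rewrite -big_split big_distrr -big_split.
Qed.

Section CaterpillarWiener.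
Variables (q : nat) (t : nat -> nat).
Local Notation cat := (caterpillar q t).
Local Notation pendant := {j : 'I_(uphalf q) & 'I_(t j.+1)}.

Lemma cat_dist_spine (i j : 'I_q.+2) : dist (inl i : cat) (inl j) = (i - j) + (j - i).
Proof. by rewrite cat_distE /cat_dist /=; case: eqP => [[->]|_]; lia. Qed.

(** The blocks path-path, pendant-path and pendant-pendant are compared one by one with those of the
    tree; the first block is the same in both. *)
Lemma wiener_cat_split : 2 * Wiener cat =
  \sum_(i < q.+2) \sum_(j < q.+2) ((i - j) + (j - i)) +
  2 * \sum_(s : pendant) \sum_(i < q.+2) (((tag s).+1 - i) + (i - (tag s).+1) + 1) +
  \sum_(s : pendant) \sum_(s' : pendant) dist (inr s : cat) (inr s').
Proof.
rewrite wiener_double; [|by move=> x; rewrite cat_distE /cat_dist eqxx|exact: cat_distC].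
rewrite sum_sym_sumType; last exact: cat_distC.
congr (_ + 2 * _ + _); apply: eq_bigr => i _; apply: eq_bigr => j _.
  exact: cat_dist_spine.
by rewrite cat_distE /cat_dist /=; lia.
Qed.

End CaterpillarWiener.

Section Comparison.
Variables (G : sgraph) (treeG : is_tree G) (x0 xD : G).
Local Notation D := (dist x0 xD).
Hypothesis diam : forall x y : G, dist x y <= D.
Variables (q : nat) (t : nat -> nat).
Hypothesis Dq : q.+1 = D.
Local Notation cat := (caterpillar q t).
Local Notation pendant := {j : 'I_(uphalf q) & 'I_(t j.+1)}.
Variable phi : cat -> G.
Hypotheses (phi_bij : bijective phi).
Hypothesis phi_spine : forall i : 'I_q.+2, phi (inl i) = spine x0 xD i.
Hypothesis phi_off : forall s : pendant, 0 < height x0 xD (phi (inr s)).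
Hypothesis phi_ecc : forall s : pendant, ecc (phi (inr s)) = D - tag s.

Local Notation ht s := (height x0 xD (phi (inr s))).
Local Notation ft s := (foot x0 xD (phi (inr s))).

Lemma tag_lt_D (s : pendant) : tag s < D.
Proof. by have := ltn_ord (tag s); lia. Qed.

Lemma inr_eq (s s' : pendant) : (inr s == inr s' :> cat) = (s == s').
Proof. by []. Qed.

Lemma tree_dist_spine (i j : 'I_q.+2) :
  dist (phi (inl i)) (phi (inl j)) = (i - j) + (j - i).
Proof.
have leD (k : 'I_q.+2) : k <= D by rewrite -Dq -ltnS.
rewrite !phi_spine (dist_spine treeG diam) //.
by have [-> ->] := spine_foot treeG (leD i); rewrite add0n.
Qed.

Lemma wiener_tree_split : 2 * Wiener G =
  \sum_(i < q.+2) \sum_(j < q.+2) ((i - j) + (j - i)) +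
  2 * \sum_(s : pendant) \sum_(i < q.+2) (ht s + ((ft s - i) + (i - ft s))) +
  \sum_(s : pendant) \sum_(s' : pendant) dist (phi (inr s)) (phi (inr s')).
Proof.
rewrite wiener_double; [|exact: tree_distxx|exact: tree_distC].
rewrite (reindex phi) /=; last by apply: onW_bij.
rewrite (eq_bigr (fun u => \sum_v dist (phi u) (phi v))) => [|u _]; last first.
  by rewrite (reindex phi) //; apply: onW_bij.
rewrite (@sum_sym_sumType _ _ (fun u v => dist (phi u) (phi v))); last first.
  by move=> u v; apply: tree_distC.
congr (_ + 2 * _ + _); apply: eq_bigr => i _; apply: eq_bigr => j _.
  exact: tree_dist_spine.
by rewrite phi_spine (dist_spine treeG diam) ?addnA // -Dq -ltnS.
Qed.

(** Height g + 1 and eccentricity D - a put the foot at distance a + g + 1 from the nearer end, as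
    [sum_dist_path_shift] requires. *)
Lemma spine_sum_lower (s : pendant) :
  \sum_(i < q.+2) (((tag s).+1 - i) + (i - (tag s).+1) + 1) + 4 * (ht s).-1 <=
  \sum_(i < q.+2) (ht s + ((ft s - i) + (i - ft s))).
Proof.
have [_ _ le1 le2] := foot_height treeG diam (phi (inr s)).
have := phi_ecc s; rewrite (eccE treeG diam) => e.
have := tag_lt_D s; have := phi_off s; move: e le1 le2; rewrite -Dq.
move: (ht s) (ft s) (nat_of_ord (tag s)) => [//|g] f a e le1 le2 _ lta /=.
by apply: sum_dist_path_shift => //; lia.
Qed.

Lemma spine_sums_lower :
  \sum_(s : pendant) \sum_(i < q.+2) (((tag s).+1 - i) + (i - (tag s).+1) + 1)
    + 4 * \sum_(s : pendant) (ht s).-1 <=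
  \sum_(s : pendant) \sum_(i < q.+2) (ht s + ((ft s - i) + (i - ft s))).
Proof.
by rewrite big_distrr -big_split; apply: leq_sum => s _; apply: spine_sum_lower.
Qed.

Lemma sum_ancestor (s : pendant) :
  \sum_(s' : pendant) ancestor x0 xD (phi (inr s')) (phi (inr s)) <= (ht s).-1.
Proof.
apply: leq_trans (card_ancestor treeG diam (phi (inr s))).
rewrite -sum1_card [leqRHS]big_mkcond /= (reindex phi) /=; last exact: onW_bij.
by rewrite big_sumType /= -[leqLHS]add0n leq_add.
Qed.

Lemma pendant_dist_le (s s' : pendant) :
  dist (inr s : cat) (inr s') <= dist (phi (inr s)) (phi (inr s')) +
    2 * (ancestor x0 xD (phi (inr s')) (phi (inr s)) +
         ancestor x0 xD (phi (inr s)) (phi (inr s'))).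
Proof.
rewrite cat_distE /cat_dist inr_eq; case: eqVneq => // ne.
have neq : phi (inr s) != phi (inr s').
  by rewrite (bij_eq phi_bij) inr_eq.
have := dist_off_lower treeG diam (phi_off s) (phi_off s') neq.
have := tag_lt_D s; have := tag_lt_D s'; rewrite !phi_ecc /=.
by lia.
Qed.

(** In ordered pairs the path distances gain 8 per unit of excess height, while the ancestor pairs
    lose at most 4 per unit. The surplus of 4 is kept because it forces height 1 in case of
    equality. *)
Lemma wiener_lower :
  2 * Wiener cat + 4 * \sum_(s : pendant) (ht s).-1 <= 2 * Wiener G.
Proof.
rewrite wiener_cat_split wiener_tree_split.
have le1 := spine_sums_lower.
have le2 : \sum_(s : pendant) \sum_(s' : pendant)
    ancestor x0 xD (phi (inr s')) (phi (inr s)) <= \sum_(s : pendant) (ht s).-1.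
  by apply: leq_sum => s _; apply: sum_ancestor.
have le3 : \sum_(s : pendant) \sum_(s' : pendant) dist (inr s : cat) (inr s') <=
    \sum_(s : pendant) \sum_(s' : pendant) (dist (phi (inr s)) (phi (inr s')) +
    2 * (ancestor x0 xD (phi (inr s')) (phi (inr s)) +
         ancestor x0 xD (phi (inr s)) (phi (inr s')))).
  by apply: leq_sum => s _; apply: leq_sum => s' _; apply: pendant_dist_le.
rewrite (sum_sym_correction (fun s s' => dist (phi (inr s)) (phi (inr s')))
  (fun s s' => ancestor x0 xD (phi (inr s')) (phi (inr s)) : nat)) in le3.
have arith A X Xc O Oc g a : Xc + 4 * g <= X -> a <= g -> Oc <= O + 4 * a ->
    A + 2 * Xc + Oc + 4 * g <= A + 2 * X + O by lia.
exact: arith le1 le2 le3.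
Qed.

(** * The equality case *)

Hypothesis wiener_le : Wiener G <= Wiener cat.

Lemma height1 (s : pendant) : ht s = 1.
Proof.
have := wiener_lower; have := phi_off s.
by rewrite (bigD1 s) //=; move: wiener_le; lia.
Qed.

(** At height 1 there are no ancestors, so no pendant distance is larger in the caterpillar. The
    total is not smaller there, so equality holds first for each row and then for each pair. *)
Lemma pendant_dist_eq (s s' : pendant) :
  dist (inr s : cat) (inr s') = dist (phi (inr s)) (phi (inr s')).
Proof.
have noanc s1 s2 : ancestor x0 xD (phi (inr s1)) (phi (inr s2)) = false.
  by apply/negP => /and4P[_ _]; rewrite !height1.
have le s1 s2 : dist (inr s1 : cat) (inr s2) <= dist (phi (inr s1)) (phi (inr s2)).
  by have := pendant_dist_le s1 s2; rewrite !noanc !addn0.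
apply: (@sum_le_pointwise_eq _ (fun s' => dist (inr s : cat) (inr s'))
          (fun s' => dist (phi (inr s)) (phi (inr s')))) => //.
rewrite (@sum_le_pointwise_eq _
  (fun s => \sum_s' dist (inr s : cat) (inr s'))
  (fun s => \sum_s' dist (phi (inr s)) (phi (inr s')))) //.
  by move=> s1; apply: leq_sum.
have arith W Wc A X Xc O Oc g : 2 * W = A + 2 * X + O -> 2 * Wc = A + 2 * Xc + Oc ->
    Xc + 4 * g <= X -> W <= Wc -> O <= Oc by lia.
exact: arith wiener_tree_split (wiener_cat_split q t) spine_sums_lower wiener_le.
Qed.

(* Pendants on both sides of the centre would be farther apart in [G] than in
   the caterpillar, which has all of them on the side of [x0]. *)
Lemma one_sided :
  (forall s : pendant, ft s <= D - ft s) \/ (forall s : pendant, D - ft s <= ft s).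
Proof.
have [/forallP H|] := boolP [forall s : pendant, ft s <= D - ft s]; first by left.
rewrite negb_forall => /existsP ex; right=> s'.
have {ex} [s gts] : exists s : pendant, D - ft s < ft s.
  by case: ex => s; rewrite -ltnNge => gts; exists s.
rewrite leqNgt; apply/negP => lts'.
have := pendant_dist_eq s s'; rewrite cat_distE /cat_dist inr_eq.
have ne : foot x0 xD (phi (inr s)) != foot x0 xD (phi (inr s')) by lia.
rewrite (dist_foot treeG diam ne) !height1; case: eqVneq => [e|_] /=.
  by rewrite e eqxx in ne.
have := phi_ecc s; have := phi_ecc s'; rewrite !(eccE treeG diam) !height1.
have [_ _ _ l1] := foot_height treeG diam (phi (inr s)).
have [_ _ _ l2] := foot_height treeG diam (phi (inr s')).
have arith d f f' a a' : a < d -> a' < d -> d - f < f -> f' < d - f' ->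
    f <= d -> f' <= d ->
    1 + maxn f' (d - f') = d - a' -> 1 + maxn f (d - f) = d - a ->
    a.+1 - a'.+1 + (a'.+1 - a.+1) + 1 + 1 = 1 + 1 + (f - f') + (f' - f) -> False.
  by lia.
exact: (arith _ _ _ _ _ (tag_lt_D s) (tag_lt_D s') gts lts'
  (leq_trans (leq_addr _ _) l1) (leq_trans (leq_addr _ _) l2)).
Qed.

(** Height and eccentricity fix a foot up to reflection of the path, and the side assumption removes
    the ambiguity, so [phi] preserves all distances. *)
Lemma one_sided_iso : (forall s : pendant, ft s <= D - ft s) -> isomorphic cat G.
Proof.
move=> left_side; exists phi; split=> // u v; rewrite -!dist1_edge.
have leD (i : 'I_q.+2) : i <= D by rewrite -Dq -ltnS.
have ds (s : pendant) (i : 'I_q.+2) :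
    dist (phi (inr s)) (phi (inl i)) = dist (inr s : cat) (inl i).
  rewrite phi_spine (dist_spine treeG diam) // height1 cat_distE /cat_dist /=.
  have [_ _ _ le] := foot_height treeG diam (phi (inr s)).
  have arith d f a : a < d -> f <= d - f -> f <= d ->
    1 + maxn f (d - f) = d - a -> f = a.+1 by lia.
  have := phi_ecc s; rewrite (eccE treeG diam) height1.
  move/(arith _ _ _ (tag_lt_D s) (left_side s) (leq_trans (leq_addr _ _) le)) => ->.
  by lia.
case: u v => [i|s] [j|s']; rewrite ?ds ?pendant_dist_eq //.
  by rewrite tree_dist_spine cat_dist_spine.
by rewrite (tree_distC treeG) ds cat_distC.
Qed.

End Comparison.

(** * Eccentricity levels *)

Lemma isomorphic_sym (G H : sgraph) : isomorphic G H -> isomorphic H G.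
Proof.
case=> f [[g fK gK] fE]; exists g; split; first by exists f.
by move=> x y; rewrite -fE !gK.
Qed.

Section EccentricityLevels.
Variables (G : sgraph) (treeG : is_tree G) (x0 xD : G).
Local Notation D := (dist x0 xD).
Hypothesis diam : forall x y : G, dist x y <= D.

Lemma ecc_bounds (x : G) : D <= 2 * ecc x /\ ecc x <= D.
Proof.
have [_ _ le1 le2] := foot_height treeG diam x.
by rewrite (eccE treeG diam); split; lia.
Qed.

(** Off-path vertices thus avoid the central level, which is why pendants are needed only at the
    first [D./2] inner path vertices. *)
Lemma ecc_off_gt (x : G) : 0 < height x0 xD x -> D + 2 <= 2 * ecc x.
Proof. by rewrite (eccE treeG diam); lia. Qed.

Lemma ecc_spine i : i <= D -> ecc (spine x0 xD i) = maxn i (D - i).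
Proof. by move=> le; rewrite (eccE treeG diam); have [-> ->] := spine_foot treeG le. Qed.

(** Exactly two path vertices have eccentricity [c], those numbered [c] and [D - c]; they differ
    because [D < 2 * c]. *)
Lemma card_ecc_level c : D < 2 * c -> c <= D ->
  #|[pred x : G | ecc x == c]| =
    #|[pred x : G | (0 < height x0 xD x) && (ecc x == c)]| + 2.
Proof.
move=> ltc lec; rewrite -(cardID [pred x | 0 < height x0 xD x]); congr (_ + _).
  by apply: eq_card => x; rewrite !inE andbC.
have ne : spine x0 xD c != spine x0 xD (D - c).
  apply/eqP => e; have [f1 _] := spine_foot treeG lec.
  have [f2 _] := spine_foot treeG (leq_subr c D); move: f1; rewrite e f2; lia.
have <- : #|[set spine x0 xD c; spine x0 xD (D - c)]| = 2 by rewrite cards2 ne.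
apply: eq_card => x; rewrite !inE -eqn0Ngt; apply/andP/orP => [[/eqP h0]|].
  rewrite (height0_spine treeG diam h0); have [_ _ _ le] := foot_height treeG diam x.
  rewrite ecc_spine; last by lia.
  move: (foot x0 xD x) le => f le /eqP e.
  have [->|->] : f = c \/ f = D - c by lia.
    by left.
  by right.
case=> /eqP ->; rewrite ecc_spine ?leq_subr //; last first.
  by have [_ ->] := spine_foot treeG (leq_subr c D); split=> //; lia.
by have [_ ->] := spine_foot treeG lec; split=> //; lia.
Qed.

End EccentricityLevels.

Section SpineBijection.
Variables (G : sgraph) (treeG : is_tree G) (x0 xD : G).
Local Notation D := (dist x0 xD).
Hypothesis diam : forall x y : G, dist x y <= D.
Variables (q : nat) (t : nat -> nat).
Hypothesis Dq : q.+1 = D.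
Hypothesis level : forall k, k < uphalf q ->
  #|[pred x : G | ecc x == D - k]| = t k.+1 + 2.

Lemma spine_bijection : exists phi : caterpillar q t -> G,
  [/\ bijective phi,
      forall i : 'I_q.+2, phi (inl i) = spine x0 xD i,
      forall s, 0 < height x0 xD (phi (inr s))
    & forall s, ecc (phi (inr s)) = D - tag s].
Proof.
pose off := {x : G | 0 < height x0 xD x}.
pose pendant : finType := {j : 'I_(uphalf q) & 'I_(t j.+1)}.
have card_eq k : #|[pred a : off | D - ecc (val a) == k]| =
                 #|[pred s : pendant | tag s == k :> nat]|.
  have -> : #|[pred a : off | D - ecc (val a) == k]| =
      #|[pred x : G | (0 < height x0 xD x) && (D - ecc x == k)]|.
    rewrite -(card_image val_inj); apply: eq_card => x; rewrite !inE.
    apply/imageP/andP => [[a]|[hx ex]].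
      by rewrite inE => ea ->; split=> //; apply: (valP a).
    by exists (exist _ x hx); rewrite ?inE.
  (* Beyond this range both fibres are empty: tags are smaller, and off-path vertices have larger
     eccentricity. *)
  have [ltk|gek] := ltnP k (uphalf q); last first.
    rewrite !eq_card0 // => [s|x]; rewrite !inE.
      by apply/eqP => e; have := ltn_ord (tag s); lia.
    apply/negP => /andP[/(ecc_off_gt treeG diam)].
    by have [_] := ecc_bounds treeG diam x; lia.
  have -> : #|[pred s : pendant | tag s == k :> nat]| = t k.+1.
    pose j := Ordinal ltk; rewrite -sum1_card.
    rewrite (eq_bigl (fun s : pendant => (tag s == j) && predT (tagged s))); last first.
      by move=> s; rewrite !inE andbT.
    rewrite -(@sig_big_dep _ _ _ _ _ (fun j => j == _) (fun _ => predT) (fun _ _ => 1)).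
    by rewrite big_pred1_eq sum1_card card_ord.
  apply/eqP; rewrite -(eqn_add2r 2) -(level ltk) (@card_ecc_level _ treeG x0 xD diam); try lia.
  rewrite eqn_add2r; apply/eqP; apply: eq_card => x; rewrite !inE; congr (_ && _).
  by have [_] := ecc_bounds treeG diam x; lia.
have [phi0 [psi0 K1 K2] phi0E] := fiber_bij card_eq.
pose phi (u : caterpillar q t) : G :=
  match u with inl i => spine x0 xD i | inr s => val (phi0 s) end.
pose psi (x : G) : caterpillar q t :=
  if insub x is Some a then inr (psi0 a) else inl (inord (foot x0 xD x)).
have phi_off s : 0 < height x0 xD (phi (inr s)) := valP (phi0 s).
exists phi; split=> //.
  exists psi => [[i|s]|x].
  - have lei : i <= D by rewrite -Dq -ltnS.
    have [fi hi] := spine_foot treeG lei.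
    by rewrite /psi /= insubN ?hi // fi inord_val.
  - by rewrite /psi /= valK K1.
  rewrite /psi; case: insubP => [a _ <-|]; first by rewrite /= K2.
  rewrite -eqn0Ngt => /eqP h0; have [_ _ _ le] := foot_height treeG diam x.
  rewrite [RHS](height0_spine treeG diam h0) /= inordK //.
  by rewrite Dq ltnS; lia.
move=> s; have [_ le] := ecc_bounds treeG diam (val (phi0 s)).
by rewrite -phi0E subKn.
Qed.

End SpineBijection.

(** * Reading [l], [b] and [m] off a tree *)

Lemma expand_seq_count l (b m : nat -> nat) c :
  count_mem c (expand_seq l b m) = \sum_(1 <= i < l.+1) (b i == c) * m i.
Proof.
rewrite /expand_seq count_flatten -map_comp sumnE big_map /index_iota subn1.
by apply: eq_bigr => i _; rewrite /= count_nseq.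
Qed.

Lemma expand_seq_size l (b m : nat -> nat) :
  size (expand_seq l b m) = \sum_(1 <= i < l.+1) m i.
Proof.
rewrite /expand_seq size_flatten /shape -map_comp sumnE big_map /index_iota subn1.
by apply: eq_bigr => i _; rewrite /= size_nseq.
Qed.

Section TreeLevels.
Variables (l : nat) (b m : nat -> nat) (T : sgraph).
Hypothesis (hS : exponent_form l b m).
Hypothesis (hT : in_trees_with (expand_seq l b m) T).

Lemma exponent_mono i j : 1 <= i -> i <= j -> j <= l -> b i <= b j.
Proof.
have [bS _] := hS => i1; rewrite leq_eqVlt => /predU1P[->//|ltij] jl.
by apply: ltnW; apply: bS.
Qed.

Lemma card_ecc_expand c :
  #|[pred x : T | ecc x == c]| = \sum_(1 <= i < l.+1) (b i == c) * m i.
Proof.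
have [_ eS] := hT; rewrite -expand_seq_count -eS /ecc_seq.
have /permP -> := permEl (perm_sort leq [seq ecc x | x <- enum T]).
rewrite count_map cardE size_filter enumT; apply: eq_count => x.
by rewrite /= inE.
Qed.

Lemma ecc_value (x : T) : exists2 i, 1 <= i <= l & b i = ecc x.
Proof.
have : 0 < \sum_(1 <= i < l.+1) (b i == ecc x) * m i.
  by rewrite -card_ecc_expand; apply/card_gt0P; exists x; rewrite inE.
rewrite big_nat; have [/hasP[i]|/hasPn none] :=
    boolP (has (fun i => b i == ecc x) (index_iota 1 l.+1)).
  by rewrite mem_index_iota ltnS => il /eqP bi _; exists i.
rewrite -big_nat big_seq big1 // => i /none /negbTE ->.
by rewrite mul0n.
Qed.

Lemma card_ecc_value i : 1 <= i <= l -> #|[pred x : T | ecc x == b i]| = m i.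
Proof.
move=> /andP[i1 il]; rewrite card_ecc_expand.
have il' : i \in index_iota 1 l.+1 by rewrite mem_index_iota i1 ltnS il.
rewrite (bigD1_seq i) ?iota_uniq //= eqxx mul1n big_seq_cond big1 ?addn0 //.
move=> j; rewrite mem_index_iota ltnS => /andP[/andP[j1 jl] nji].
have [bS _] := hS; have [lt|gt|e] := ltngtP j i; last by rewrite e eqxx in nji.
  by have := bS j i j1 lt il; case: eqP => [->|]; rewrite ?ltnn.
by have := bS i j i1 gt jl; case: eqP => [->|]; rewrite ?ltnn.
Qed.

Lemma value_ecc i : 1 <= i <= l -> exists x : T, ecc x = b i.
Proof.
move=> il; have [_ m1] := hS; have := m1 i il; rewrite -(card_ecc_value il).
by case/card_gt0P=> x; rewrite inE => /eqP; exists x.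
Qed.

Lemma diametral_pair : 2 < \sum_(1 <= i < l.+1) m i ->
  exists x0 xD : T, 0 < dist x0 xD /\ forall x y : T, dist x y <= dist x0 xD.
Proof.
move=> hn; have [treeT eS] := hT.
have cT : 2 < #|T|.
  by move: hn; rewrite -(expand_seq_size l b) -eS size_sort size_map -cardE.
have /card_gt0P[x _] : 0 < #|T| by lia.
have [/= p _ pmax] := @arg_maxnP (T * T)%type (x, x) predT (fun p => dist p.1 p.2) isT.
exists p.1, p.2; have mx (u v : T) : dist u v <= dist p.1 p.2 by apply: (pmax (u, v)).
split=> //; rewrite lt0n; apply/eqP => d0.
have : #|T| <= 1.
  apply/card_le1_eqP => u v _ _; apply: (tree_dist_eq0 treeT).
  by apply/eqP; rewrite -leqn0 -d0.
by lia.
Qed.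

Section Diameter.
Variables (x0 xD : T).
Local Notation D := (dist x0 xD).
Hypotheses (D0 : 0 < D) (diam : forall x y : T, dist x y <= D).

(** Path vertex number [c] has eccentricity [c], so no value in this range is skipped. *)
Lemma level_range c : D <= 2 * c -> c <= D -> exists2 i, 1 <= i <= l & b i = c.
Proof.
move=> le1 le2; have [treeT _] := hT; have [i il bi] := ecc_value (spine x0 xD c).
by exists i; rewrite // bi (ecc_spine treeT diam) //; lia.
Qed.

Lemma level_bounds i : 1 <= i <= l -> D <= 2 * b i /\ b i <= D.
Proof.
by move=> /value_ecc[x <-]; have [treeT _] := hT; exact: ecc_bounds.
Qed.

Lemma last_level : 1 <= l /\ b l = D.
Proof.
have [i /andP[i1 il] bi] : exists2 i, 1 <= i <= l & b i = D by apply: level_range; lia.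
have l1 := leq_trans i1 il; split=> //; apply/eqP; rewrite eqn_leq.
have [_ ->] : D <= 2 * b l /\ b l <= D by apply: level_bounds; rewrite l1 leqnn.
by rewrite -bi exponent_mono.
Qed.

Lemma level_value k : k < l -> b (l - k) = D - k.
Proof.
have [l1 bl] := last_level; elim: k => [|k IH] lt; first by rewrite !subn0.
have {}IH := IH (ltnW lt); have [bS _] := hS.
have lt1 : b (l - k.+1) < b (l - k) by apply: bS; lia.
have [b1 b2] : D <= 2 * b (l - k.+1) /\ b (l - k.+1) <= D by apply: level_bounds; lia.
have [i /andP[i1 il] bi] : exists2 i, 1 <= i <= l & b i = D - k.+1.
  by apply: level_range; lia.
have [le|gt] := leqP i (l - k.+1).
  have : b i <= b (l - k.+1) by apply: exponent_mono; lia.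
  by lia.
have : b (l - k) <= b i by apply: exponent_mono; lia.
by lia.
Qed.

(** The levels descend from [D] in unit steps, and the least one is [uphalf D], attained at the
    centre of the path. *)
Lemma level_count : l = D./2.+1.
Proof.
have [l1 bl] := last_level; have [i /andP[i1 il] bi] : exists2 i, 1 <= i <= l & b i = uphalf D.
  by apply: level_range; lia.
have b1 : b 1 = D - l.-1.
  by rewrite -level_value ?prednK ?leqnn //; congr b; lia.
have := @exponent_mono 1 i isT i1 il.
have [] : D <= 2 * b 1 /\ b 1 <= D by apply: level_bounds; lia.
(* This excludes truncation in [D - l.-1]: otherwise level [l - D] would have value 0 although
   [D > 0]. *)
have : l.-1 <= D.
  have [//|gt] := leqP l.-1 D; have [] := @level_bounds (l - D); first by lia.
  by rewrite level_value ?subnn; lia.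
by lia.
Qed.

Lemma card_level k : k < uphalf (b l - 1) ->
  #|[pred x : T | ecc x == D - k]| = m (l - k).
Proof.
have [_ ->] := last_level; have := level_count => el lt.
have kl : k < l by lia.
by rewrite -level_value // card_ecc_value //; lia.
Qed.

(** Levels from the second on lie above half the diameter, so two path vertices belong to each. *)
Lemma mult_ge2 i : 2 <= i <= l -> 2 <= m i.
Proof.
have [treeT _] := hT; move=> /andP[i2 il]; have el := level_count.
have k : l - i < uphalf (b l - 1) by have [_ ->] := last_level; lia.
have -> : i = l - (l - i) by lia.
rewrite -card_level // (card_ecc_level treeT diam); lia.
Qed.

Lemma level_bijection : exists phi : min_tree l b m -> T,
  [/\ bijective phi,
      forall i : 'I_(b l - 1).+2, phi (inl i) = spine x0 xD i,
      forall s, 0 < height x0 xD (phi (inr s))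
    & forall s, ecc (phi (inr s)) = D - tag s].
Proof.
have [treeT _] := hT; have [_ bl] := last_level; have el := level_count.
apply: (spine_bijection treeT diam); first by lia.
move=> k lt; rewrite card_level //.
have := @mult_ge2 (l - k); rewrite addn1 subSS => m2.
by rewrite subnK // m2 //; lia.
Qed.

End Diameter.

End TreeLevels.

Lemma min_tree_optimal l (b m : nat -> nat) (T : sgraph) :
  exponent_form l b m -> in_trees_with (expand_seq l b m) T ->
  2 < \sum_(1 <= i < l.+1) m i ->
  ~ isomorphic T (min_tree l b m) -> Wiener (min_tree l b m) < Wiener T.
Proof.
move=> hS hT hn niso; rewrite ltnNge; apply/negP => le; apply: niso.
have [treeT _] := hT; apply: isomorphic_sym.
have [x0 [xD [D0 diam]]] := diametral_pair hT hn.
(* The reversed path serves the case where all pendants hang on the half of [xD]. *)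
have diam' (x y : T) : dist x y <= dist xD x0 by rewrite (tree_distC treeT xD); apply: diam.
have D0' : 0 < dist xD x0 by rewrite (tree_distC treeT xD).
have Dq : (b l - 1).+1 = dist x0 xD.
  by have [_ ->] := last_level hS hT D0 diam; rewrite subn1 prednK.
have [phi [p1 p2 p3 p4]] := level_bijection hS hT D0 diam.
case: (one_sided treeT diam Dq p1 p2 p3 p4 le) => [|right_side].
  exact: (one_sided_iso treeT diam Dq p1 p2 p3 p4 le).
have Dq' : (b l - 1).+1 = dist xD x0 by rewrite (tree_distC treeT xD).
have [psi [q1 q2 q3 q4]] := level_bijection hS hT D0' diam'.
apply: (one_sided_iso treeT diam' Dq' q1 q2 q3 q4 le) => s.
(* Reversal keeps heights and reflects feet. *)
have flip : height x0 xD (psi (inr s)) = height xD x0 (psi (inr s)) /\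
    foot xD x0 (psi (inr s)) = dist x0 xD - foot x0 xD (psi (inr s)).
  have [a1 a2 _ a3] := foot_height treeT diam (psi (inr s)).
  have [c1 c2 _ c3] := foot_height treeT diam' (psi (inr s)).
  have e1 := tree_distC treeT x0 (psi (inr s)).
  have e2 := tree_distC treeT xD (psi (inr s)).
  by have e3 := tree_distC treeT xD x0; lia.
have [eh ->] := flip; rewrite (tree_distC treeT xD).
have [_ _ _ le1] := foot_height treeT diam (psi (inr s)).
rewrite subKn; last by apply: leq_trans le1; apply: leq_addr.
have hx : 0 < height x0 xD (psi (inr s)) by rewrite eh.
(* [right_side] concerns images under [phi], so the vertex is written as such an image; positive
   height rules out a path vertex. *)
have [phi' _ pK] := p1; move: hx; rewrite -(pK (psi (inr s))).
case: (phi' (psi (inr s))) => [i|s']; last by move=> _; apply: right_side.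
have lei : i <= dist x0 xD by rewrite -Dq -ltnS.
by rewrite p2; have [_ ->] := spine_foot treeT lei.
Qed.

(** * The Wiener index of a caterpillar *)

Lemma sum_sym_triangle n (F : 'I_n -> 'I_n -> nat) :
  (forall i j, F i j = F j i) ->
  \sum_i \sum_j F i j = \sum_i F i i + 2 * \sum_(i < n) \sum_(j < n | j < i) F i j.
Proof.
move=> FC; have -> : 2 * \sum_(i < n) \sum_(j < n | j < i) F i j =
    \sum_(i < n) \sum_(j < n | j < i) F i j + \sum_(i < n) \sum_(j < n | i < j) F i j.
  rewrite mul2n -addnn; congr (_ + _); rewrite (exchange_big_dep predT) //=.
  by apply: eq_bigr => j _; apply: eq_bigr => i _.
rewrite -!big_split /=; apply: eq_bigr => i _.
rewrite (bigD1 i) //= (bigID (fun j : 'I_n => j < i)) /=; congr (_ + (_ + _)).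
  by apply: eq_bigl => j; rewrite -val_eqE /=; case: ltngtP.
by apply: eq_bigl => j; rewrite -val_eqE /=; case: ltngtP.
Qed.

Lemma sum_bin2 n : \sum_(i < n.+1) 'C(i.+1, 2) = 'C(n.+2, 3).
Proof. by elim: n => [|n IH]; rewrite big_ord_recr /= ?big_ord0 // IH [in RHS]binS. Qed.

(** Twice the Wiener index of a path with [n] edges. The two binomial sums agree under reversal and
    are evaluated by the hockey-stick identity. *)
Lemma sum_dist_path_pairs n :
  \sum_(i < n.+1) \sum_(j < n.+1) ((i - j) + (j - i)) = 2 * 'C(n.+2, 3).
Proof.
rewrite (eq_bigr (fun i : 'I_n.+1 => 'C(i.+1, 2) + 'C((n - i).+1, 2))); last first.
  by move=> i _; rewrite sum_dist_path // -ltnS.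
rewrite big_split /= -sum_bin2 mul2n -addnn; congr (_ + _).
by rewrite (reindex_inj rev_ord_inj) /=; apply: eq_bigr => i _; rewrite subSS subKn // -ltnS.
Qed.

Section CaterpillarFormula.
Variables (q : nat) (t : nat -> nat).
Local Notation pendant := {j : 'I_(uphalf q) & 'I_(t j.+1)}.

Lemma sum_pendant (F : 'I_(uphalf q) -> nat) :
  \sum_(s : pendant) F (tag s) = \sum_(j < uphalf q) t j.+1 * F j.
Proof.
rewrite -(@sig_big_dep _ _ _ _ _ predT (fun _ => predT) (fun j _ => F j)).
by apply: eq_bigr => j _; rewrite sum_nat_const card_ord.
Qed.

Lemma wiener_caterpillar : Wiener (caterpillar q t) =
  'C(q.+3, 3) + \sum_(j < uphalf q) t j.+1 * (t j.+1).-1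
  + \sum_(i < uphalf q) \sum_(j < uphalf q | j < i) t i.+1 * t j.+1 * (2 + (i - j))
  + \sum_(j < uphalf q) ('C(j.+2, 2) + 'C(q.+1 - j, 2)) * t j.+1
  + q.+2 * \sum_(j < uphalf q) t j.+1.
Proof.
apply/eqP; rewrite -(@eqn_pmul2l 2) // wiener_cat_split sum_dist_path_pairs.
have -> : \sum_(s : pendant) \sum_(i < q.+2) (((tag s).+1 - i) + (i - (tag s).+1) + 1) =
    \sum_(j < uphalf q) ('C(j.+2, 2) + 'C(q.+1 - j, 2)) * t j.+1
    + q.+2 * \sum_(j < uphalf q) t j.+1.
  rewrite (sum_pendant (fun j => \sum_(i < q.+2) ((j.+1 - i) + (i - j.+1) + 1))).
  rewrite big_distrr -big_split; apply: eq_bigr => j _ /=.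
  rewrite big_split /= sum_dist_path ?sum_nat_const ?card_ord; last first.
    by have := ltn_ord j; lia.
  rewrite subSS -subSn; last by have := ltn_ord j; lia.
  by rewrite muln1 mulnDr mulnC [_ * q.+2]mulnC.
(* Adding 2 for each pendant extends the formula 2 + |i - j| to the diagonal, so the sum can be
   grouped by attachment vertices. *)
have pair_sum : \sum_(s : pendant) \sum_(s' : pendant)
      dist (inr s : caterpillar q t) (inr s') + 2 * \sum_(j < uphalf q) t j.+1 =
    2 * \sum_(j < uphalf q) t j.+1 * t j.+1
    + 2 * \sum_(i < uphalf q) \sum_(j < uphalf q | j < i) t i.+1 * t j.+1 * (2 + (i - j)).
  transitivity (\sum_(s : pendant) \sum_(s' : pendant)
      (2 + ((tag s - tag s') + (tag s' - tag s)))).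
    have -> : \sum_(j < uphalf q) t j.+1 = \sum_(s : pendant) 1.
      by rewrite (sum_pendant (fun _ => 1)); apply: eq_bigr => j _; rewrite muln1.
    rewrite big_distrr -big_split; apply: eq_bigr => s _ /=.
    rewrite (bigD1 s) //= [RHS](bigD1 s) //= cat_distE /cat_dist eqxx subnn !addn0 addnC.
    congr (_ + _); apply: eq_bigr => s' ne.
    rewrite cat_distE /cat_dist eq_sym [X in if X then _ else _](negbTE ne) /=.
    by rewrite !subSS -addnA addnC.
  rewrite (eq_bigr (fun s : pendant =>
      \sum_(j < uphalf q) t j.+1 * (2 + ((tag s - j) + (j - tag s))))); last first.
    by move=> s _; rewrite (sum_pendant (fun j => 2 + ((tag s - j) + (j - tag s)))).
  rewrite (sum_pendant (fun i => \sum_(j < uphalf q) t j.+1 * (2 + ((i - j) + (j - i))))).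
  rewrite (eq_bigr (fun i : 'I_(uphalf q) =>
      \sum_(j < uphalf q) t i.+1 * t j.+1 * (2 + ((i - j) + (j - i))))); last first.
    by move=> i _; rewrite big_distrr; apply: eq_bigr => j _ /=; rewrite mulnA.
  rewrite sum_sym_triangle; last first.
    by move=> i j; rewrite [t i.+1 * _]mulnC [(i - j) + _]addnC.
  congr (_ + 2 * _).
    by rewrite big_distrr; apply: eq_bigr => i _; rewrite subnn addn0 mulnC.
  apply: eq_bigr => i _; apply: eq_bigr => j lt; congr (_ * (2 + _)).
  by rewrite (eqP (ltnW lt)) addn0.
have sq : \sum_(j < uphalf q) t j.+1 * t j.+1 =
    \sum_(j < uphalf q) t j.+1 * (t j.+1).-1 + \sum_(j < uphalf q) t j.+1.
  rewrite -big_split; apply: eq_bigr => j _ /=.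
  by case: (t j.+1) => // k; rewrite mulnSr.
by rewrite sq in pair_sum; lia.
Qed.

End CaterpillarFormula.

(** * The closed formula over the integers *)

Local Open Scope ring_scope.

(** Level [l - a] of the sequence corresponds to tag [a] of the caterpillar. *)
Lemma sum_rev (l : nat) (F : nat -> int) :
  \sum_(2 <= j < l.+1) F j = \sum_(a < l.-1) F (l - a)%N.
Proof.
rewrite big_nat_rev !big_add1 big_mkord /=.
by apply: eq_bigr => a _; congr F; lia.
Qed.

Lemma Posz_sum (I : finType) (P : pred I) (F : I -> nat) :
  (\sum_(i | P i) F i)%N%:Z = \sum_(i | P i) (F i)%:Z.
Proof. exact: (big_morph Posz PoszD (erefl 0)). Qed.

Lemma min_tree_wiener (l : nat) (b m : nat -> nat) :
  (0 < b l)%N -> l = (b l)./2.+1 -> (forall i, 2 <= i <= l -> 2 <= m i)%N ->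
  (Wiener (min_tree l b m))%:Z =
      'C((b l + 2)%N, 3)%:Z
    + \sum_(2 <= j < l.+1) ((m j)%:Z - 2) * ((m j)%:Z - 3)
    + \sum_(2 <= i < l.+1) \sum_(i.+1 <= j < l.+1)
        ((m i)%:Z - 2) * ((m j)%:Z - 2) * (2 + j%:Z - i%:Z)
    + \sum_(1 <= j < l)
        ('C((j + 1)%N, 2)%:Z + 'C((b l + 1 - j)%N, 2)%:Z)
          * ((m (l + 1 - j)%N)%:Z - 2)
    + ((b l)%:Z + 1) * (2 - 2 * l%:Z + \sum_(2 <= j < l.+1) (m j)%:Z).
Proof.
move=> b0 el m2; rewrite /min_tree wiener_caterpillar.
have eq : uphalf (b l - 1) = l.-1 by lia.
have mt (a : 'I_l.-1) : (m (l - a)%N)%:Z = (m (l + 1 - a.+1) - 2)%N%:Z + 2.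
  have := m2 (l - a)%N; rewrite addn1 subSS; have := ltn_ord a; lia.
have cast (x1 x2 x3 x4 x5 : nat) :
    (x1 + x2 + x3 + x4 + x5)%N%:Z = x1%:Z + x2%:Z + x3%:Z + x4%:Z + x5%:Z by lia.
rewrite cast eq !sum_rev; congr (_ + _ + _ + _ + _).
- by congr (Posz (binomial _ _)); lia.
- by rewrite Posz_sum; apply: eq_bigr => a _; rewrite mt; move: (_ - 2)%N => [|k]; lia.
(* The inner range is widened to start at 2 under a condition, which the reversal turns into
   [c < a]. *)
- rewrite Posz_sum; apply: eq_bigr => a _; rewrite Posz_sum (@big_nat_widenl _ _ _ _ 2); last first.
    by have := ltn_ord a; lia.
  rewrite big_mkcond sum_rev -big_mkcond /=.
  apply: eq_big => [c|c lt]; first by have := ltn_ord a; have := ltn_ord c; lia.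
  rewrite !mt; have := ltn_ord a.
  by move: (_ - 2)%N (m _ - 2)%N => x y; lia.
- rewrite big_add1 big_mkord Posz_sum; apply: eq_bigr => a _.
  rewrite PoszM PoszD; congr ((_ + _) * _).
    by congr (Posz (binomial _ _)); lia.
    by congr (Posz (binomial _ _)); lia.
  by have := mt a; rewrite !addn1 !subSS; lia.
rewrite PoszM Posz_sum; congr (_ * _); first by lia.
(* The [l.-1] summands 2 split off here cancel against 2 - 2 l. *)
rewrite (eq_bigr _ (fun a _ => mt a)) big_split /= sumr_const card_ord.
by rewrite -mulr_natr natz; move: (\sum_(i < _) _) => x; lia.
Qed.

Theorem theorem4 (l : nat) (b m : nat -> nat)
  (hS : exponent_form l b m)
  (htree : tree_ecc_seq (expand_seq l b m))
  (hn : (2 < \sum_(1 <= i < l.+1) m i)%N) :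
  (forall T : sgraph, in_trees_with (expand_seq l b m) T ->
     ~ isomorphic T (min_tree l b m) ->
     (Wiener (min_tree l b m) < Wiener T)%N)
  /\
  (Wiener (min_tree l b m))%:Z =
      'C((b l + 2)%N, 3)%:Z
    + \sum_(2 <= j < l.+1) ((m j)%:Z - 2) * ((m j)%:Z - 3)
    + \sum_(2 <= i < l.+1) \sum_(i.+1 <= j < l.+1)
        ((m i)%:Z - 2) * ((m j)%:Z - 2) * (2 + j%:Z - i%:Z)
    + \sum_(1 <= j < l)
        ('C((j + 1)%N, 2)%:Z + 'C((b l + 1 - j)%N, 2)%:Z)
          * ((m (l + 1 - j)%N)%:Z - 2)
    + ((b l)%:Z + 1) * (2 - 2 * l%:Z + \sum_(2 <= j < l.+1) (m j)%:Z).
Proof.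
split=> [T hT niso|]; first exact: (min_tree_optimal hS hT hn niso).
(* Any tree realising the sequence supplies the arithmetic conditions on [l], [b] and [m]. *)
have [T hT] := htree; have [x0 [xD [D0 diam]]] := diametral_pair hT hn.
have [_ bl] := last_level hS hT D0 diam.
apply: min_tree_wiener; first by rewrite bl.
  by rewrite bl; exact: (level_count hS hT D0 diam).
exact: (mult_ge2 hS hT D0 diam).
Qed.
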